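(* Let $n,m$ be positive integers and let $\Phi$ be an $m\times n$ random matrix whose entries are independent and each equal to $+1/\sqrt{m}$ or $-1/\sqrt{m}$ with probability $1/2$ each. For a nonzero $x\in\mathbb{R}^n$ define the distortion $$E(x) = \frac{\|\Phi x\|_2^2}{\|x\|_2^2} - 1 .$$ Then: (a) For every positive integer $q$, the moment $\mathbf{E}\,E(x)^q$ depends on $x$ only through $(x_1^2,\ldots,x_n^2)$, the quantity $\|x\|_2^{2q}\,\mathbf{E}\,E(x)^q$ is a polynomial in $(x_1^2,\ldots,x_n^2)$, and $\mathbf{E}\,E(x)^q$ is a Schur-concave function of $(x_1^2,\ldots,x_n^2)$. (b) Let $K=\|x\|_0$ be the number of nonzero coordinates of $x$, let $B\sim\mathsf{Binom}(K,1/2)$, and let $Z_1,\ldots,Z_m$ be i.i.d. copies of the standardized variable $\frac{B-\mathbf{E}B}{\sqrt{\mathbf{Var}[B]}}$. Define $$E_* = \frac{1}{m}\sum_{i=1}^m (Z_i^2-1).$$ Then for every integer $q\ge 2$, $$\mathbf{E}\,E(x)^q \le \mathbf{E}\,E_*^q,$$ with equality when all components of $x$ are equal.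
   Context: A function $f:D\to\mathbb{R}$ on a symmetric domain $D\subseteq\mathbb{R}^n$ is Schur-concave if $f(a)\ge f(b)$ whenever $a$ is majorized by $b$ (i.e. $a\prec b$: the sum of the $k$ largest entries of $a$ is at most that of $b$ for every $k$, with equal total sums). $\|x\|_0$ denotes the number of nonzero coordinates of $x$. *)

(* Defs.v *)
From HB Require Import structures.
From mathcomp Require Import all_boot all_order all_algebra.
From mathcomp Require Import mpoly.
Set Implicit Arguments. Unset Strict Implicit. Unset Printing Implicit Defensive.
Import Order.TTheory GRing.Theory Num.Theory.
Local Open Scope ring_scope.

Section Defs.
Variable R : rcfType.

(* The random sign matrix: a uniformly random s : 'M[bool]_(m,n)
   (independent fair signs), Phi = (+-1/sqrt m)-matrix. *)
Definition Phi (m n : nat) (s : 'M[bool]_(m, n)) : 'M[R]_(m, n) :=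
  \matrix_(i, j) ((if s i j then 1 else -1) / Num.sqrt (m%:R)).

Definition sqnorm (k : nat) (v : 'cV[R]_k) : R := \sum_(i < k) v i 0 ^+ 2.

Definition distortion (m n : nat) (s : 'M[bool]_(m, n)) (x : 'cV[R]_n) : R :=
  sqnorm (Phi s *m x) / sqnorm x - 1.

Definition moment (m n q : nat) (x : 'cV[R]_n) : R :=
  (\sum_(s : 'M[bool]_(m, n)) distortion s x ^+ q) / (#|{: 'M[bool]_(m, n)}|%:R).

Definition topsum (n : nat) (a : 'I_n -> R) (k : nat) : R :=
  let s := sort (fun u v : R => v <= u) [seq a i | i <- enum 'I_n] in
  \sum_(i < k) s`_i.

Definition majorized (n : nat) (a b : 'I_n -> R) : Prop :=
  (forall k, (k <= n)%N -> topsum a k <= topsum b k) /\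
  \sum_(i < n) a i = \sum_(i < n) b i.

Definition l0 (n : nat) (x : 'cV[R]_n) : nat := #|[set i : 'I_n | x i 0 != 0]|.

(* standardized Binom(K,1/2) value: (b - E B)/sqrt(Var B), E B = K/2, Var B = K/4 *)
Definition zstd (K b : nat) : R := (b%:R - K%:R / 2%:R) / Num.sqrt (K%:R / 4%:R).

(* E [ E_*^q ] with Z_1..Z_m i.i.d. standardized Binom(K,1/2):
   expectation over (B_1,...,B_m) in {0..K}^m with product binomial weights *)
Definition Estar_moment (m K q : nat) : R :=
  \sum_(b : {ffun 'I_m -> 'I_K.+1})
     (\prod_(i < m) ('C(K, b i)%:R / 2%:R ^+ K)) *
     ((m%:R)^-1 * \sum_(i < m) (zstd K (b i) ^+ 2 - 1)) ^+ q.

Definition schur_concave (n : nat) (D : ('I_n -> R) -> Prop) (f : ('I_n -> R) -> R) : Prop :=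
  forall a b, D a -> D b -> majorized a b -> f b <= f a.
End Defs.

(* Main.v *)
(** Up to the factor [m * sqnorm x], the distortion is a sum over the independent
    rows [s] of [Q s x = (\sum_i s i * x i) ^+ 2 - \sum_i x i ^+ 2].  Expanding the
    [q]-th power of the sum shows that its moment is a polynomial with nonnegative
    coefficients in the row moments [E (Q ^+ k)], so it suffices to study one row.

    Averaging over signs kills every monomial with an odd exponent, whence the
    polynomial dependence on the squares.  For two coordinates [j] and [k], put
    [e = s j * s k]; given [e], the sign [s k] is still uniform and only even powers
    of its coefficient survive.  That coefficient squared is
    [4 * (x j ^+ 2 + x k ^+ 2 + 2 * e * x j * x k) * T ^+ 2], where [T] is the
    signed sum of the other coordinates, so the row moment is an average
    over signs of a polynomial with nonnegative coefficients in the signs, in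
    [x j ^+ 2 + x k ^+ 2] and in [x j * x k]; hence it increases with [x j * x k]
    when the sum of squares is fixed.  Majorization is a chain of such
    transfers, and so is averaging the squares over the support; the moment of a
    vector constant on its support is computed from the binomial law. *)

Require Import Defs.
From HB Require Import structures.
From mathcomp Require Import all_boot all_order all_algebra.
From mathcomp Require Import perm mpoly ring lra.
Set Implicit Arguments. Unset Strict Implicit. Unset Printing Implicit Defensive.
Import Order.TTheory GRing.Theory Num.Theory.
Local Open Scope ring_scope.

(** * Moments of sums of i.i.d. variables *)

Section IidMoment.
Variable R : realFieldType.

Definition iid_moment (T : finType) (w g : T -> R) (m q : nat) : R :=
  \sum_(s : {ffun 'I_m -> T})
     (\prod_(i < m) w (s i)) * (\sum_(i < m) g (s i)) ^+ q.

(** Here [f] records which summand is chosen in each of the [q] factors. Grouping the factors by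
    their choice lets independence split every term into moments of a single variable. *)
Lemma iid_momentE (T : finType) (w g : T -> R) (m q : nat) :
  iid_moment w g m q =
  \sum_(f : {ffun 'I_q -> 'I_m})
     \prod_(i < m) \sum_t w t * g t ^+ #|[set l | f l == i]|.
Proof.
rewrite /iid_moment.
have expand s : (\sum_(i < m) g (s i)) ^+ q =
    \sum_(f : {ffun 'I_q -> 'I_m}) \prod_(i < m) g (s i) ^+ #|[set l | f l == i]|.
  rewrite -{1}(card_ord q) -prodr_const bigA_distr_bigA /=.
  apply: eq_bigr => f _; rewrite (partition_big f xpredT) //=.
  apply: eq_bigr => i _; rewrite -prodr_const.
  by apply: eq_big => [l|l /eqP -> //]; rewrite inE.
under eq_bigr do rewrite expand mulr_sumr.
rewrite exchange_big /=; apply: eq_bigr => f _.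
by rewrite bigA_distr_bigA /=; apply: eq_bigr => s _; rewrite -big_split.
Qed.

(** The expansions are compared factor by factor; multiplying the inequalities requires the lower
    bound [0]. *)
Lemma le_iid_moment (T U : finType) (w g : T -> R) (w' g' : U -> R) (m q : nat) :
  (forall k, 0 <= \sum_t w t * g t ^+ k <= \sum_u w' u * g' u ^+ k) ->
  iid_moment w g m q <= iid_moment w' g' m q.
Proof.
move=> le_wg; rewrite !iid_momentE; apply: ler_sum => f _.
by apply: ler_prod => i _; apply: le_wg.
Qed.

Lemma eq_iid_moment (T U : finType) (w g : T -> R) (w' g' : U -> R) (m q : nat) :
  (forall k, \sum_t w t * g t ^+ k = \sum_u w' u * g' u ^+ k) ->
  iid_moment w g m q = iid_moment w' g' m q.
Proof.
move=> eq_wg; rewrite !iid_momentE; apply: eq_bigr => f _.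
by apply: eq_bigr => i _.
Qed.

End IidMoment.

(** * Averages over signs *)

Section SignAverage.
Variables (R : realFieldType) (n : nat).
Implicit Types (p q : {mpoly R[n]}) (x : 'I_n -> R).

Definition sg (b : bool) : R := if b then 1 else -1.

Lemma sg_sqr b : sg b ^+ 2 = 1.
Proof. by case: b; rewrite /sg ?sqrrN expr1n. Qed.

Lemma sum_sgX (y : R) k :
  \sum_(b : bool) (sg b * y) ^+ k = if odd k then 0 else 2 * (y ^+ 2) ^+ k./2.
Proof.
rewrite big_bool /sg /= mul1r mulN1r exprNn -signr_odd -exprM mul2n.
rewrite -{1 2}[in y ^+ k](odd_double_half k).
case: (odd k); first by rewrite expr1 mulN1r subrr.
by rewrite expr0 mul1r add0n mulr_natl mulr2n.
Qed.

Lemma sum_signs_meval p x :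
  \sum_(s : {ffun 'I_n -> bool}) p.@[fun i => sg (s i) * x i] =
  \sum_(mu <- msupp p)
     p@_mu * \prod_i (if odd (mu i) then 0 else 2 * (x i ^+ 2) ^+ (mu i)./2).
Proof.
under eq_bigr do rewrite mevalE.
rewrite exchange_big /=; apply: eq_bigr => mu _.
rewrite -mulr_sumr; congr (_ * _).
under [RHS]eq_bigr do rewrite -sum_sgX.
by rewrite bigA_distr_bigA.
Qed.

Lemma sum_signs_poly p : exists P : {mpoly R[n]}, forall x,
  \sum_(s : {ffun 'I_n -> bool}) p.@[fun i => sg (s i) * x i] =
  P.@[fun i => x i ^+ 2].
Proof.
exists (\sum_(mu <- msupp p)
   p@_mu *: \prod_i (if odd (mu i) then 0 else 2 *: 'X_i ^+ (mu i)./2)).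
move=> x; rewrite sum_signs_meval rmorph_sum /=; apply: eq_bigr => mu _.
rewrite mevalZ rmorph_prod; congr (_ * _); apply: eq_bigr => i _ /=.
by case: ifP => _; rewrite ?meval0 // mevalZ rmorphXn /= mevalXU.
Qed.

(** * Polynomials with nonnegative coefficients *)

Definition nneg_coef p := forall mu, 0 <= p@_mu.

(** Summed over all signs, a monomial gives [0] or [2 ^+ n], never a negative value. *)
Lemma sum_signs_ge0 p : nneg_coef p ->
  0 <= \sum_(s : {ffun 'I_n -> bool}) p.@[fun i => sg (s i)].
Proof.
move=> p_ge0.
have -> : \sum_(s : {ffun 'I_n -> bool}) p.@[fun i => sg (s i)] =
    \sum_(s : {ffun 'I_n -> bool}) p.@[fun i => sg (s i) * 1].
  by apply: eq_bigr => s _; apply: meval_eq => i; rewrite mulr1.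
rewrite (sum_signs_meval p (fun=> 1)) sumr_ge0 // => mu _.
rewrite mulr_ge0 ?p_ge0 // prodr_ge0 // => i _.
by case: ifP => // _; rewrite expr1n expr1n mulr1 ler0n.
Qed.

Lemma nneg_coefC (c : R) : 0 <= c -> nneg_coef c%:MP.
Proof. by move=> c0 mu; rewrite mcoeffC mulr_ge0 ?ler0n. Qed.

Lemma nneg_coefX i : nneg_coef 'X_i.
Proof. by move=> mu; rewrite mcoeffX ler0n. Qed.

Lemma nneg_coefD p q : nneg_coef p -> nneg_coef q -> nneg_coef (p + q).
Proof. by move=> p0 q0 mu; rewrite mcoeffD addr_ge0. Qed.

Lemma nneg_coefM p q : nneg_coef p -> nneg_coef q -> nneg_coef (p * q).
Proof.
move=> p0 q0 mu; rewrite mcoeffM sumr_ge0 // => k _.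
by rewrite mulr_ge0.
Qed.

Lemma nneg_coefZ (c : R) p : 0 <= c -> nneg_coef p -> nneg_coef (c *: p).
Proof. by move=> c0 p0 mu; rewrite mcoeffZ mulr_ge0. Qed.

Lemma nneg_coef_sum (I : finType) (P : pred I) (F : I -> {mpoly R[n]}) :
  (forall i, P i -> nneg_coef (F i)) -> nneg_coef (\sum_(i | P i) F i).
Proof.
move=> F0; apply: big_ind => //; last exact: nneg_coefD.
by move=> mu; rewrite mcoeff0.
Qed.

(* The pair [(E_k, O_k)] with [(A + B) ^+ k = E_k + B * O_k] when [B ^+ 2 = D]. *)
Fixpoint evod (S : comNzRingType) (A D : S) (k : nat) : S * S :=
  if k is k'.+1 then
    let eo := evod A D k' in (A * eo.1 + D * eo.2, eo.1 + A * eo.2)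
  else (1, 0).

Lemma exprD_evod (S : comNzRingType) (A B : S) k :
  (A + B) ^+ k = (evod A (B ^+ 2) k).1 + B * (evod A (B ^+ 2) k).2.
Proof.
elim: k => [|k IH] /=; first by rewrite mulr0 addr0.
by rewrite exprS IH; ring.
Qed.

Lemma evod_meval (v : 'I_n -> R) p q k :
  ((evod p q k).1.@[v] = (evod p.@[v] q.@[v] k).1) *
  ((evod p q k).2.@[v] = (evod p.@[v] q.@[v] k).2).
Proof.
elim: k => [|k [IH1 IH2]] /=; first by rewrite meval1 meval0.
by rewrite !mevalD !mevalM IH1 IH2.
Qed.

Lemma nneg_coef_evod p q k : nneg_coef p -> nneg_coef q ->
  nneg_coef (evod p q k).1 /\ nneg_coef (evod p q k).2.
Proof.
move=> p0 q0; elim: k => [|k [IH1 IH2]] /=.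
  by split; [exact: (nneg_coefC ler01) | move=> mu; rewrite mcoeff0].
by split; apply: nneg_coefD; rewrite //; apply: nneg_coefM.
Qed.

Lemma nneg_coef_mulB p p' q q' : nneg_coef p -> nneg_coef q' ->
  nneg_coef (p' - p) -> nneg_coef (q' - q) -> nneg_coef (p' * q' - p * q).
Proof.
move=> p0 q0 pp' qq'.
have -> : p' * q' - p * q = (p' - p) * q' + p * (q' - q) by ring.
by apply: nneg_coefD; apply: nneg_coefM.
Qed.

(** The recursion of [evod] uses only sums and products, which are monotone for the coefficientwise
    order on polynomials with nonnegative coefficients. *)
Lemma nneg_coef_evodB p q p' q' k : nneg_coef p -> nneg_coef q ->
    nneg_coef (p' - p) -> nneg_coef (q' - q) ->
  nneg_coef ((evod p' q' k).1 - (evod p q k).1) /\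
  nneg_coef ((evod p' q' k).2 - (evod p q k).2).
Proof.
move=> p0 q0 pp' qq'.
have p'0 : nneg_coef p' by rewrite -(subrK p p'); apply: nneg_coefD.
have q'0 : nneg_coef q' by rewrite -(subrK q q'); apply: nneg_coefD.
elim: k => [|k [IH1 IH2]] /=.
  by rewrite !subrr; split=> mu; rewrite mcoeff0.
have [E0 O0] := nneg_coef_evod k p0 q0.
have [E'0 O'0] := nneg_coef_evod k p'0 q'0.
split; rewrite opprD addrACA; apply: nneg_coefD; rewrite //;
  by apply: nneg_coef_mulB.
Qed.

End SignAverage.

(** * One row of the sign matrix *)

Section RowForm.
Variables (R : realFieldType) (n : nat).
Implicit Types (x y : 'I_n -> R) (s : {ffun 'I_n -> bool}).
Local Notation sg := (sg R).

(** The off-diagonal part of the squared signed sum: as signs square to [1], the diagonal terms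
    cancel. *)
Definition rowQ s x : R := (\sum_i sg (s i) * x i) ^+ 2 - \sum_i x i ^+ 2.

(** * Dependence of a row on two coordinates *)

Section TwoCoordinates.
Variables j k : 'I_n.
Hypothesis neq_jk : j != k.

(** On booleans [==] is the product of signs, so this is the substitution [s j := s j * s k]. *)
Definition twist s : {ffun 'I_n -> bool} :=
  [ffun i => if i == j then s j == s k else s i].

Definition flip s : {ffun 'I_n -> bool} :=
  [ffun i => if i == k then ~~ s k else s i].

Lemma twistK : involutive twist.
Proof.
move=> s; apply/ffunP => i; rewrite !ffunE eqxx [k == j]eq_sym (negPf neq_jk).
by case: eqP => [->|//]; case: (s j); case: (s k).
Qed.

Lemma flipK : involutive flip.
Proof.
move=> s; apply/ffunP => i; rewrite !ffunE eqxx.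
by case: eqP => [->|//]; rewrite negbK.
Qed.

Definition restT x : {mpoly R[n]} := \sum_(i | (i != j) && (i != k)) x i *: 'X_i.

(** The off-diagonal part of the square of [restT x], spelled out because subtracting the sum of
    squares as a constant would introduce a negative coefficient. *)
Definition restU x : {mpoly R[n]} :=
  \sum_(i | (i != j) && (i != k)) \sum_(l | (l != j) && (l != k) && (l != i))
     (x i * x l) *: ('X_i * 'X_l).

(** After the twist, [rowQ] is the sum of [pA], free of [s k], and a term odd in [s k] whose square
    is [pD]. *)
Definition pA x : {mpoly R[n]} := (2 * (x j * x k)) *: 'X_j + restU x.

Definition pD x : {mpoly R[n]} :=
  ((4 * (x j ^+ 2 + x k ^+ 2))%:MP + (8 * (x j * x k)) *: 'X_j)
  * (restT x * restT x).

Definition restt x s : R := \sum_(i | (i != j) && (i != k)) sg (s i) * x i.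

Lemma restT_meval x s : (restT x).@[fun i => sg (s i)] = restt x s.
Proof.
rewrite rmorph_sum; apply: eq_bigr => i _ /=.
by rewrite mevalZ mevalXU mulrC.
Qed.

Lemma restU_meval x s : (restU x).@[fun i => sg (s i)] =
  restt x s ^+ 2 - \sum_(i | (i != j) && (i != k)) x i ^+ 2.
Proof.
apply/eqP; rewrite eq_sym subr_eq; apply/eqP.
rewrite rmorph_sum -big_split /= expr2 {1}/restt mulr_suml.
apply: eq_bigr => i Pi; rewrite /restt (bigD1 i) //= mulrDr addrC.
congr (_ + _); first by rewrite mulrACA -!expr2 sg_sqr mul1r.
rewrite mulr_sumr rmorph_sum; apply: eq_bigr => l _ /=.
by rewrite mevalZ mevalM !mevalXU; ring.
Qed.

Lemma pA_meval x s : (pA x).@[fun i => sg (s i)] =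
  2 * (x j * x k) * sg (s j) + restt x s ^+ 2
  - \sum_(i | (i != j) && (i != k)) x i ^+ 2.
Proof. by rewrite mevalD mevalZ mevalXU restU_meval addrA. Qed.

Lemma pD_meval x s : (pD x).@[fun i => sg (s i)] =
  (sg (s k) * (2 * (sg (s j) * x j + x k) * restt x s)) ^+ 2.
Proof.
rewrite !mevalM mevalD mevalC mevalZ mevalXU restT_meval.
by rewrite exprMn sg_sqr mul1r /sg; case: (s j); ring.
Qed.

(** The twisted pair contributes [s k * (s j * x j + x k)] to the signed sum; only its cross product
    with the rest keeps the sign [s k]. *)
Lemma rowQ_twist x s : rowQ (twist s) x =
  (pA x).@[fun i => sg (s i)]
  + sg (s k) * (2 * (sg (s j) * x j + x k) * restt x s).
Proof.
rewrite /rowQ pA_meval (bigD1 j) //= [X in _ - X](bigD1 j) //=.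
rewrite (bigD1 k) 1?eq_sym //= [X in _ - (_ + X)](bigD1 k) 1?eq_sym //=.
have -> : \sum_(i | (i != j) && (i != k)) sg (twist s i) * x i = restt x s.
  by apply: eq_bigr => i /andP [ij _]; rewrite ffunE (negPf ij).
rewrite !ffunE eqxx [k == j]eq_sym (negPf neq_jk) /sg.
by case: (s j); case: (s k) => /=; ring.
Qed.

(** Negating the sign at [k] preserves [pA] and [pD] and reverses the odd term, so the odd powers of
    that term cancel in the sum. *)
Lemma sum_rowQ x r : \sum_s rowQ s x ^+ r =
  \sum_(s : {ffun 'I_n -> bool}) (evod (pA x) (pD x) r).1.@[fun i => sg (s i)].
Proof.
rewrite (reindex_inj (inv_inj twistK)) /=.
pose B s := sg (s k) * (2 * (sg (s j) * x j + x k) * restt x s).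
pose h s := B s * (evod (pA x) (pD x) r).2.@[fun i => sg (s i)].
have -> : \sum_s rowQ (twist s) x ^+ r = \sum_(s : {ffun 'I_n -> bool})
    ((evod (pA x) (pD x) r).1.@[fun i => sg (s i)] + h s).
  apply: eq_bigr => s _; rewrite rowQ_twist exprD_evod /h.
  by rewrite !evod_meval pD_meval.
rewrite big_split /=.
suff -> : \sum_s h s = 0 by rewrite addr0.
have flip_t s : restt x (flip s) = restt x s.
  by apply: eq_bigr => i /andP [_ ik]; rewrite ffunE (negPf ik).
have flip_j s : flip s j = s j by rewrite ffunE (negPf neq_jk).
have flip_B s : B (flip s) = - B s.
  by rewrite /B flip_t flip_j ffunE eqxx /sg; case: (s k) => /=; ring.
have flip_h s : h (flip s) = - h s.
  rewrite /h flip_B !evod_meval !pA_meval flip_t flip_j !pD_meval -!/(B _).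
  by rewrite flip_B sqrrN mulNr.
have eq_h : \sum_s h s = - \sum_s h s.
  rewrite {1}(reindex_inj (inv_inj flipK)) -sumrN.
  by apply: eq_bigr => s _; exact: flip_h.
lra.
Qed.

(* After the substitution [s j := s j * s k] the pair enters [rowQ] only through
   [x j ^+ 2 + x k ^+ 2] and, with nonnegative coefficients, [x j * x k]. *)
Lemma sum_rowQ_transfer x y r :
    (forall i, 0 <= x i) -> (forall i, i != j -> i != k -> y i = x i) ->
    y j ^+ 2 + y k ^+ 2 = x j ^+ 2 + x k ^+ 2 -> x j * x k <= y j * y k ->
  0 <= \sum_s rowQ s x ^+ r <= \sum_s rowQ s y ^+ r.
Proof.
move=> x0 eq_rest eq_sqr le_prod.
have T0 : nneg_coef (restT x).
  by apply: nneg_coef_sum => i _; apply: nneg_coefZ => //; apply: nneg_coefX.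
have A0 : nneg_coef (pA x).
  apply: nneg_coefD.
    by apply: nneg_coefZ; [rewrite !mulr_ge0|apply: nneg_coefX].
  apply: nneg_coef_sum => i _; apply: nneg_coef_sum => l _.
  apply: nneg_coefZ; first exact: mulr_ge0.
  by apply: nneg_coefM; apply: nneg_coefX.
have D0 : nneg_coef (pD x).
  apply: nneg_coefM; last exact: nneg_coefM.
  apply: nneg_coefD; first by apply: nneg_coefC; rewrite mulr_ge0 ?addr_ge0 ?sqr_ge0.
  by apply: nneg_coefZ; [rewrite !mulr_ge0|apply: nneg_coefX].
have eqT : restT y = restT x.
  by apply: eq_bigr => i /andP [ij ik]; rewrite eq_rest.
have eqU : restU y = restU x.
  apply: eq_bigr => i /andP [ij ik].
  by apply: eq_bigr => l /andP [/andP [lj lk] _]; rewrite !eq_rest.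
(* Only the coefficient of ['X_j] changes, and it grows with the product of the two coordinates; the
   same holds for the first factor of [pD]. *)
have AB : nneg_coef (pA y - pA x).
  have -> : pA y - pA x = (2 * (y j * y k - x j * x k)) *: 'X_j.
    by rewrite /pA eqU opprD addrACA subrr addr0 -scalerBl mulrBr.
  by apply: nneg_coefZ; [rewrite mulr_ge0 ?subr_ge0|apply: nneg_coefX].
have DB : nneg_coef (pD y - pD x).
  have -> : pD y - pD x =
      (8 * (y j * y k - x j * x k)) *: 'X_j * (restT x * restT x).
    by rewrite /pD eqT eq_sqr -mulrBl opprD addrACA subrr add0r -scalerBl mulrBr.
  apply: nneg_coefM; last exact: nneg_coefM.
  by apply: nneg_coefZ; [rewrite mulr_ge0 ?subr_ge0|apply: nneg_coefX].
rewrite !sum_rowQ sum_signs_ge0; last by case: (nneg_coef_evod r A0 D0).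
rewrite -subr_ge0 -sumrB.
under eq_bigr do rewrite -mevalB.
by apply: sum_signs_ge0; case: (nneg_coef_evodB r A0 D0 AB DB).
Qed.

End TwoCoordinates.

Lemma sum_rowQ_perm x (p : {perm 'I_n}) r :
  \sum_s rowQ s (x \o p) ^+ r = \sum_s rowQ s x ^+ r.
Proof.
pose h (p : {perm 'I_n}) s : {ffun 'I_n -> bool} := [ffun i => s (p i)].
have hK : cancel (h p) (h p^-1%g).
  by move=> s; apply/ffunP => i; rewrite !ffunE permKV.
rewrite (reindex_inj (can_inj hK)); apply: eq_bigr => s _; congr (_ ^+ _).
rewrite /rowQ; congr (_ ^+ 2 - _); rewrite [RHS](reindex_inj (@perm_inj _ p)) //=.
by apply: eq_bigr => i _; rewrite ffunE.
Qed.

End RowForm.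

(** * Transfers and majorization *)

Section Transfers.
Variables (R : realFieldType) (n : nat).
Implicit Types a b : 'I_n -> R.

Definition transfer b (j k : 'I_n) (d : R) : 'I_n -> R :=
  fun i => b i - (i == j)%:R * d + (i == k)%:R * d.

Lemma sum_delta (P : pred 'I_n) (j : 'I_n) (d : R) :
  \sum_(i | P i) (i == j)%:R * d = (P j)%:R * d.
Proof.
case Pj: (P j).
  by rewrite (bigD1 j) //= eqxx big1 ?addr0 // => i /andP [_ /negPf ->]; rewrite mul0r.
by rewrite mul0r big1 // => i Pi; case: eqP Pj => [<-|_]; rewrite ?Pi ?mul0r.
Qed.

Lemma sum_transfer (P : pred 'I_n) b j k d :
  \sum_(i | P i) transfer b j k d i =
  \sum_(i | P i) b i - (P j)%:R * d + (P k)%:R * d.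
Proof. by rewrite /transfer big_split sumrB /= !sum_delta. Qed.

Lemma exists_lt_of_sum a b i :
  \sum_i a i = \sum_i b i -> a i != b i -> exists k, b k < a k.
Proof.
move=> eq_sum neq_i; apply/existsP; apply: contraNT neq_i.
rewrite negb_exists => /forallP le_ab.
have ge0 l : true -> 0 <= b l - a l by rewrite subr_ge0 leNgt le_ab.
have /eqP : \sum_i (b i - a i) = 0 by rewrite sumrB eq_sum subrr.
rewrite psumr_eq0 // => /allP /(_ i (mem_index_enum i)) /=.
by rewrite subr_eq0 eq_sym.
Qed.

(** All that is used of the moment: it does not decrease when two coordinates keep their sum and
    their product grows. *)
Variable f : ('I_n -> R) -> R.
Hypothesis f_ext : forall a b, a =1 b -> f a = f b.
Hypothesis f_transfer : forall b b' j k, j != k ->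
  (forall i, 0 <= b i) -> (forall i, 0 <= b' i) -> 0 < \sum_i b i ->
  (forall i, i != j -> i != k -> b' i = b i) ->
  b' j + b' k = b j + b k -> b j * b k <= b' j * b' k -> f b <= f b'.

(* The transfer amount is chosen so that one more coordinate of [b] agrees with [a]. *)
Lemma le_of_transfers (Inv : ('I_n -> R) -> Prop) a :
    (forall i, 0 <= a i) ->
    (forall b i, Inv b -> \sum_i b i = \sum_i a i -> (forall i, 0 <= b i) ->
       a i != b i -> exists j k, [/\ a j < b j, b k < a k, a k <= a j &
         forall d, 0 <= d -> d <= b j - a j -> d <= a k - b k ->
           Inv (transfer b j k d)]) ->
  forall b, Inv b -> (forall i, 0 <= b i) -> \sum_i b i = \sum_i a i ->
    0 < \sum_i b i -> f b <= f a.
Proof.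
move=> a0 step b; have [N] := ubnP #|[set i | a i != b i]|.
elim: N b => // N IH b; rewrite ltnS => leN Ib b0 eq_sum sum0.
case: (pickP [pred i | a i != b i]) => [i /= neq_i|eq_ab]; last first.
  by rewrite (@f_ext b a) // => i; have /= /negbFE /eqP := eq_ab i.
have [j [k [ltj ltk akj Itr]]] := step b i Ib eq_sum b0 neq_i.
have neq_jk : j != k.
  by apply: contraTneq ltj => ->; rewrite -leNgt ltW.
pose d := Num.min (b j - a j) (a k - b k).
have [dj dk] : d <= b j - a j /\ d <= a k - b k.
  by rewrite /d !ge_min !lexx orbT.
have d0 : 0 <= d by rewrite le_min !subr_ge0 !ltW.
pose b' := transfer b j k d.
have b'j : b' j = b j - d.
  by rewrite /b' /transfer eqxx (negPf neq_jk) mul1r mul0r addr0.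
have b'k : b' k = b k + d.
  by rewrite /b' /transfer eqxx eq_sym (negPf neq_jk) mul1r mul0r subr0.
have b'i l : l != j -> l != k -> b' l = b l.
  by move=> /negPf lj /negPf lk; rewrite /b' /transfer lj lk !mul0r subr0 addr0.
have b'0 l : 0 <= b' l.
  have [->|lj] := eqVneq l j; first by have := a0 j; rewrite b'j; lra.
  have [->|lk] := eqVneq l k; first by rewrite b'k addr_ge0.
  by rewrite b'i.
have sum_b' : \sum_i b' i = \sum_i b i by rewrite sum_transfer /= subrK.
apply: (le_trans (y := f b')).
  apply: (f_transfer neq_jk) => //; first by rewrite b'j b'k; lra.
  (* The bounds on [d] give [b k + d <= a k <= a j <= b j - d], so the last factor is at least
     [d]. *)
  have -> : b' j * b' k = b j * b k + d * (b j - b k - d) by rewrite b'j b'k; ring.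
  by rewrite lerDl mulr_ge0 //; lra.
apply: IH => //; [|exact: Itr|by rewrite sum_b'|by rewrite sum_b'].
apply: leq_trans leN; apply: proper_card; apply/properP; split.
  apply/subsetP => l; rewrite !inE.
  have [->|lj] := eqVneq l j; first by rewrite (lt_eqF ltj).
  have [->|lk] := eqVneq l k; first by rewrite (gt_eqF ltk).
  by rewrite b'i.
have [le_d|lt_d] := leP (b j - a j) (a k - b k).
  exists j; rewrite !inE ?(lt_eqF ltj) // b'j negbK; apply/eqP.
  by rewrite /d (min_idPl le_d); lra.
exists k; rewrite !inE ?(gt_eqF ltk) // b'k negbK; apply/eqP.
by rewrite /d (min_idPr (ltW lt_d)); lra.
Qed.

(** The receiver [k] is the first index with [b k < a k], the giver [j] an earlier index with a
    surplus. Sortedness of [a] gives [a k <= a j], and domination of prefix sums is the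
    invariant. *)
Lemma le_of_prefix_sums a b :
    (forall i, 0 <= a i) -> (forall i, 0 <= b i) ->
    (forall i l : 'I_n, (i <= l)%N -> a l <= a i) ->
    (forall t, (t <= n)%N ->
       \sum_(i < n | (i < t)%N) a i <= \sum_(i < n | (i < t)%N) b i) ->
    \sum_i b i = \sum_i a i -> 0 < \sum_i b i -> f b <= f a.
Proof.
move=> a0 b0 sorted_a le_prefix eq_sum sum0.
pose Inv b := forall t, (t <= n)%N ->
  \sum_(i < n | (i < t)%N) a i <= \sum_(i < n | (i < t)%N) b i.
apply: (le_of_transfers (Inv := Inv)) => // {b b0 le_prefix eq_sum sum0}.
move=> b i Ib eq_sum b0 neq_i.
have [k0 ltk0] := exists_lt_of_sum (esym eq_sum) neq_i.
case: (@arg_minnP _ k0 (fun k => b k < a k) (fun k => k : nat) ltk0) => k ltk mink.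
have le_k (l : 'I_n) : (l < k)%N -> a l <= b l.
  by move=> lk; rewrite leNgt; apply/negP => /mink; rewrite leqNgt lk.
(* Without a surplus before [k], the two vectors would agree there, and the prefix sum ending at [k]
   would be smaller for [b]. *)
have [j /andP [jk ltj]] : exists j : 'I_n, (j < k)%N && (a j < b j).
  apply/existsP; apply: contraTT ltk => /existsPn no_j; rewrite -leNgt.
  have := Ib k.+1 (ltn_ord k).
  have split_k c : \sum_(i < n | (i < k.+1)%N) c i =
      c k + \sum_(i < n | (i < k)%N) c i :> R.
    rewrite (bigD1 k) //=; congr (_ + _); apply: eq_bigl => l.
    by rewrite ltnS ltn_neqAle andbC.
  rewrite !split_k [X in _ <= _ + X](eq_bigr a) ?lerD2r // => l lk.
  apply/eqP; rewrite eq_le le_k // andbT leNgt.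
  by have := no_j l; rewrite lk.
exists j, k; split=> // [|d d0 dj dk t tn]; first exact/sorted_a/ltnW.
rewrite sum_transfer.
case: (ltnP k t) => kt.
  by rewrite (ltn_trans jk kt) mul1r subrK Ib.
case: (ltnP j t) => jt; last by rewrite !mul0r subr0 addr0 Ib.
(* Between [j] and [k] the prefix sum of [b] drops by [d]; the surplus at [j] pays for it, and the
   other terms satisfy [a l <= b l]. *)
rewrite mul1r mul0r addr0 -subr_ge0 addrAC -sumrB (bigD1 j) //=.
rewrite addrAC addr_ge0 ?subr_ge0 // sumr_ge0 // => l /andP [lt _].
by rewrite subr_ge0 le_k // (leq_trans lt).
Qed.

(** The target is constant on [A], so any coordinate above it can give to any coordinate below it.
    Both lie in [A] because [b] and the target vanish outside; this vanishing of [b] is the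
    invariant. *)
Lemma le_of_average (A : {set 'I_n}) (c : R) b :
    0 <= c -> (forall i, 0 <= b i) -> (forall i, i \notin A -> b i = 0) ->
    \sum_i b i = \sum_i (if i \in A then c else 0) -> 0 < \sum_i b i ->
  f b <= f (fun i => if i \in A then c else 0).
Proof.
move=> c0 b0 bA eq_sum sum0.
apply: (le_of_transfers (Inv := fun b => forall i, i \notin A -> b i = 0)) => //.
  by move=> i; case: ifP.
move=> {b0 bA eq_sum sum0} b' i bA eq_sum b0 neq_i.
have [k ltk] := exists_lt_of_sum (esym eq_sum) neq_i.
rewrite eq_sym in neq_i; have [j ltj] := exists_lt_of_sum eq_sum neq_i.
have kA : k \in A by move: ltk (b0 k); case: ifP => // _; rewrite ltNge => /negPf ->.
have jA : j \in A.
  by apply: contraTT ltj => jA; rewrite bA // (negPf jA) ltxx.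
exists j, k; rewrite ltj ltk kA jA; split=> // d _ _ _ l lA.
have [/negPf lj /negPf lk] : l != j /\ l != k.
  by split; apply: contraNneq lA => ->.
by rewrite /transfer lj lk !mul0r subr0 addr0 bA.
Qed.

End Transfers.

(** A sorting permutation turns top sums into prefix sums, the form used by [le_of_prefix_sums]. *)
Lemma topsum_perm (R : rcfType) (n : nat) (a : 'I_n -> R) :
  exists p : {perm 'I_n},
    (forall i l : 'I_n, (i <= l)%N -> a (p l) <= a (p i)) /\
    (forall t, (t <= n)%N -> topsum a t = \sum_(i < n | (i < t)%N) a (p i)).
Proof.
rewrite /topsum; set s := sort _ _.
have s_perm : perm_eq s [tuple a i | i < n] by rewrite perm_sort /= perm_refl.
have [p def_s] := tuple_permP s_perm.
have nth_s (i : 'I_n) : s`_i = a (p i).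
  by rewrite def_s -(tnth_nth _ _ i) !tnth_mktuple.
have size_s : size s = n by rewrite size_sort size_map size_enum_ord.
exists p; split=> [i l il|t tn].
  rewrite -!nth_s.
  have ge_trans : transitive (fun u v : R => v <= u) by move=> u v w uv wu; apply: le_trans uv.
  have ge_refl : reflexive (fun u v : R => v <= u) by move=> u; apply: lexx.
  apply: (sorted_leq_nth ge_trans ge_refl 0); rewrite ?inE ?size_s //.
  by apply: sort_sorted => u v; apply: le_total.
rewrite (big_ord_widen _ (fun i => s`_i) tn).
by apply: eq_bigr => i _; rewrite nth_s.
Qed.

(** * Moments of the distortion *)

Lemma rowQ_ext (R : realFieldType) (n : nat) (s : {ffun 'I_n -> bool})
  (x y : 'I_n -> R) : x =1 y -> rowQ s x = rowQ s y.
Proof.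
by move=> eq_xy; rewrite /rowQ; congr (_ ^+ 2 - _);
  apply: eq_bigr => i _; rewrite eq_xy.
Qed.

Lemma rowQ_signs (R : realFieldType) (n : nat) (s t : {ffun 'I_n -> bool})
  (x : 'I_n -> R) :
  rowQ s (fun i => sg R (t i) * x i) = rowQ [ffun i => s i == t i] x.
Proof.
rewrite /rowQ; congr (_ ^+ 2 - _); apply: eq_bigr => i _.
  by rewrite ffunE /sg; case: (s i); case: (t i) => /=; ring.
by rewrite exprMn sg_sqr mul1r.
Qed.

Section Moments.
Variables (R : rcfType) (m n : nat).
Hypothesis m_gt0 : (0 < m)%N.
Implicit Types (u v : 'cV[R]_n) (x : 'I_n -> R).

Lemma sqnorm_gt0 v : v != 0 -> 0 < sqnorm v.
Proof.
move=> v0; rewrite lt_def sumr_ge0 ?andbT => [|i _]; last exact: sqr_ge0.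
apply: contraNneq v0 => /eqP; rewrite psumr_eq0 => [/allP v_eq0|i _]; last exact: sqr_ge0.
apply/eqP/colP => i; rewrite mxE.
by have := v_eq0 i (mem_index_enum i); rewrite sqrf_eq0 => /eqP.
Qed.

Definition sign_mx (f : {ffun 'I_m -> {ffun 'I_n -> bool}}) : 'M[bool]_(m, n) :=
  \matrix_(i, j) f i j.

Lemma sum_sign_mx (F : 'M[bool]_(m, n) -> R) :
  \sum_s F s = \sum_f F (sign_mx f).
Proof.
rewrite (reindex sign_mx) //=.
exists (fun s => [ffun i => [ffun j => s i j]]) => [f|s] _.
  by apply/ffunP => i; apply/ffunP => j; rewrite !ffunE mxE.
by apply/matrixP => i j; rewrite mxE !ffunE.
Qed.

(** The subtracted [1] is split evenly among the [m] rows, each losing [sqnorm v] before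
    normalization. *)
Lemma distortionE f v : v != 0 -> distortion (sign_mx f) v =
  \sum_i rowQ (f i) (fun j => v j 0) / (m%:R * sqnorm v).
Proof.
move=> v0; have S0 : sqnorm v != 0 by rewrite gt_eqF ?sqnorm_gt0.
have m0 : m%:R != 0 :> R by rewrite pnatr_eq0 -lt0n.
rewrite /distortion {1}/sqnorm -mulr_suml /rowQ sumrB.
have -> : \sum_i ((Phi R (sign_mx f) *m v) i 0) ^+ 2 =
    (\sum_i (\sum_j sg R (f i j) * v j 0) ^+ 2) / m%:R.
  rewrite mulr_suml; apply: eq_bigr => i _.
  have -> : (Phi R (sign_mx f) *m v) i 0 =
      (\sum_j sg R (f i j) * v j 0) / Num.sqrt m%:R.
    by rewrite mxE mulr_suml; apply: eq_bigr => j _; rewrite !mxE mulrAC.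
  by rewrite exprMn exprVn sqr_sqrtr ?ler0n.
rewrite sumr_const card_ord -/(sqnorm v) -mulr_natl.
by field; rewrite S0 m0.
Qed.

Lemma card_sign_mx : #|{: 'M[bool]_(m, n)}|%:R = (2 ^+ n) ^+ m :> R.
Proof. by rewrite card_mx card_bool natrX mulnC exprM. Qed.

Lemma moment_iid q v : v != 0 -> moment m q v =
  iid_moment (fun _ : {ffun 'I_n -> bool} => (2 ^+ n)^-1)
    (fun s => rowQ s (fun j => v j 0) / (m%:R * sqnorm v)) m q.
Proof.
move=> v0; rewrite /moment card_sign_mx sum_sign_mx mulr_suml.
apply: eq_bigr => f _; rewrite distortionE // mulrC; congr (_ * _).
by rewrite prodr_const card_ord exprVn.
Qed.

Lemma sum_row_moment (c d : R) x k :
  \sum_(s : {ffun 'I_n -> bool}) c * (rowQ s x / d) ^+ k =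
  c * d ^- k * \sum_(s : {ffun 'I_n -> bool}) rowQ s x ^+ k.
Proof.
rewrite mulr_sumr; apply: eq_bigr => s _.
by rewrite exprMn exprVn mulrA mulrAC.
Qed.

Lemma le_moment q u v : u != 0 -> v != 0 -> sqnorm u = sqnorm v ->
    (forall k, 0 <= \sum_(s : {ffun 'I_n -> bool}) rowQ s (fun j => u j 0) ^+ k
                 <= \sum_(s : {ffun 'I_n -> bool}) rowQ s (fun j => v j 0) ^+ k) ->
  moment m q u <= moment m q v.
Proof.
move=> u0 v0 eqS leQ; rewrite !moment_iid //; apply: le_iid_moment => k.
rewrite !sum_row_moment eqS; have /andP [Q0 leQk] := leQ k.
have c0 : 0 <= (2 ^+ n)^-1 * (m%:R * sqnorm v) ^- k.
  by rewrite mulr_ge0 ?invr_ge0 ?exprn_ge0 // mulr_ge0 ?ler0n // ltW ?sqnorm_gt0.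
by rewrite mulr_ge0 //= ler_wpM2l.
Qed.

Lemma eq_moment q u v : u != 0 -> v != 0 -> sqnorm u = sqnorm v ->
    (forall k, \sum_(s : {ffun 'I_n -> bool}) rowQ s (fun j => u j 0) ^+ k
             = \sum_(s : {ffun 'I_n -> bool}) rowQ s (fun j => v j 0) ^+ k) ->
  moment m q u = moment m q v.
Proof.
move=> u0 v0 eqS eqQ; rewrite !moment_iid //; apply: eq_iid_moment => k.
by rewrite !sum_row_moment eqS eqQ.
Qed.

(** Clearing denominators leaves a polynomial [p] whose values are unchanged by sign changes of the
    coordinates; averaging over those changes leaves only even exponents. *)
Lemma moment_poly q : exists P : {mpoly R[n]}, forall v, v != 0 ->
  sqnorm v ^+ q * moment m q v = P.@[fun i => v i 0 ^+ 2].
Proof.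
pose G x : R := \sum_(f : {ffun 'I_m -> {ffun 'I_n -> bool}})
  (\sum_i rowQ (f i) x) ^+ q.
pose p : {mpoly R[n]} := \sum_(f : {ffun 'I_m -> {ffun 'I_n -> bool}})
  (\sum_i ((\sum_j sg R (f i j) *: 'X_j) ^+ 2 - \sum_j 'X_j ^+ 2)) ^+ q.
have pG x : p.@[x] = G x.
  rewrite rmorph_sum; apply: eq_bigr => f _; rewrite rmorphXn /= rmorph_sum.
  congr (_ ^+ q); apply: eq_bigr => i _; rewrite /= mevalB rmorphXn /= !rmorph_sum.
  congr (_ ^+ 2 - _); apply: eq_bigr => j _ /=.
    by rewrite mevalZ mevalXU.
  by rewrite rmorphXn /= mevalXU.
have G_signs (t : {ffun 'I_n -> bool}) x : G (fun i => sg R (t i) * x i) = G x.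
  pose h (f : {ffun 'I_m -> {ffun 'I_n -> bool}}) :
    {ffun 'I_m -> {ffun 'I_n -> bool}} := [ffun i => [ffun j => f i j == t j]].
  have hK : involutive h.
    move=> f; apply/ffunP => i; apply/ffunP => j; rewrite !ffunE.
    by case: (f i j); case: (t j).
  rewrite /G [RHS](reindex_inj (inv_inj hK)); apply: eq_bigr => f _.
  by congr (_ ^+ q); apply: eq_bigr => i _; rewrite rowQ_signs ffunE.
have [P defP] := sum_signs_poly p.
(* The factors come from the [m] in the distortion, the number of sign matrices and the average over
   sign changes of the coordinates. *)
exists ((m%:R ^- q / (2 ^+ n) ^+ m / 2 ^+ n) *: P) => v v0.
have S0 : sqnorm v != 0 by rewrite gt_eqF ?sqnorm_gt0.
have m0 : m%:R != 0 :> R by rewrite pnatr_eq0 -lt0n.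
have two0 k : 2 ^+ k != 0 :> R by rewrite expf_neq0 ?pnatr_eq0.
rewrite mevalZ -(defP (fun i => v i 0)).
under eq_bigr do rewrite pG G_signs.
rewrite sumr_const card_ffun card_bool card_ord -[_ *+ (_ ^ _)]mulr_natl natrX [RHS]mulrA divfK //.
have -> : moment m q v = (m%:R * sqnorm v) ^- q / (2 ^+ n) ^+ m * G (fun i => v i 0).
  rewrite /moment card_sign_mx sum_sign_mx mulrAC; congr (_ / _).
  rewrite /G mulr_sumr; apply: eq_bigr => f _.
  by rewrite distortionE // -mulr_suml exprMn exprVn mulrC.
rewrite exprMn; field.
by rewrite (expf_neq0 m (two0 n)) !expf_neq0.
Qed.

Lemma moment_sqr q u v : u != 0 -> v != 0 ->
  (forall i, u i 0 ^+ 2 = v i 0 ^+ 2) -> moment m q u = moment m q v.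
Proof.
move=> u0 v0 eq_sqr; have [P defP] := moment_poly q.
have eqS : sqnorm u = sqnorm v by apply: eq_bigr => i _; rewrite eq_sqr.
have S0 : sqnorm v ^+ q != 0 by rewrite expf_neq0 // gt_eqF ?sqnorm_gt0.
by apply: (mulfI S0); rewrite -{1}eqS !defP //; apply: meval_eq.
Qed.

(** * Schur-concavity in the squares *)

Definition sqrt_col (a : 'I_n -> R) : 'cV[R]_n := \col_i Num.sqrt (a i).

Lemma sqnorm_sqrt_col (a : 'I_n -> R) :
  (forall i, 0 <= a i) -> sqnorm (sqrt_col a) = \sum_i a i.
Proof.
by move=> a0; apply: eq_bigr => i _; rewrite mxE sqr_sqrtr.
Qed.

Lemma sqrt_col_neq0 (a : 'I_n -> R) :
  (forall i, 0 <= a i) -> 0 < \sum_i a i -> sqrt_col a != 0.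
Proof.
move=> a0; apply: contraTneq => sqrt_a0; rewrite -sqnorm_sqrt_col // sqrt_a0.
by rewrite /sqnorm big1 ?ltxx // => i _; rewrite mxE expr0n.
Qed.

Lemma rowQ_sqrt_col s (a : 'I_n -> R) :
  rowQ s (fun j => sqrt_col a j 0) = rowQ s (fun j => Num.sqrt (a j)).
Proof. by apply: rowQ_ext => i; rewrite mxE. Qed.

Lemma moment_sqrt_col_ext q (a b : 'I_n -> R) : a =1 b ->
  moment m q (sqrt_col a) = moment m q (sqrt_col b).
Proof.
by move=> eq_ab; congr moment; apply/colP => i; rewrite !mxE eq_ab.
Qed.

(** Sums of entries are sums of squares of the roots, and the square root is monotone, so
    [sum_rowQ_transfer] applies to each row moment. *)
Lemma moment_transfer q (b b' : 'I_n -> R) j k : j != k ->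
    (forall i, 0 <= b i) -> (forall i, 0 <= b' i) -> 0 < \sum_i b i ->
    (forall i, i != j -> i != k -> b' i = b i) ->
    b' j + b' k = b j + b k -> b j * b k <= b' j * b' k ->
  moment m q (sqrt_col b) <= moment m q (sqrt_col b').
Proof.
move=> neq_jk b0 b'0 sum0 eq_rest eq_jk le_jk.
have eq_sum : \sum_i b' i = \sum_i b i.
  rewrite (bigD1 j) //= (bigD1 k) 1?eq_sym //= [RHS](bigD1 j) //=.
  rewrite [in RHS](bigD1 k) 1?eq_sym //= !addrA eq_jk; congr (_ + _).
  by apply: eq_bigr => i /andP [ij ik]; rewrite eq_rest.
apply: le_moment; rewrite ?sqrt_col_neq0 ?sqnorm_sqrt_col ?eq_sum // => r.
under eq_bigr do rewrite rowQ_sqrt_col.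
under [X in _ <= _ <= X]eq_bigr do rewrite rowQ_sqrt_col.
apply: (sum_rowQ_transfer neq_jk) => [i|i ij ik||].
- exact: sqrtr_ge0.
- by rewrite eq_rest.
- by rewrite !sqr_sqrtr.
by rewrite -!sqrtrM // ler_wsqrtr.
Qed.

Lemma moment_perm q (a : 'I_n -> R) (p : {perm 'I_n}) :
    (forall i, 0 <= a i) -> 0 < \sum_i a i ->
  moment m q (sqrt_col (a \o p)) = moment m q (sqrt_col a).
Proof.
move=> a0 sum0.
have eq_sum : \sum_i (a \o p) i = \sum_i a i.
  by rewrite [RHS](reindex_inj (@perm_inj _ p)).
have ap0 i : 0 <= (a \o p) i by apply: a0.
apply: eq_moment; rewrite ?sqrt_col_neq0 ?sqnorm_sqrt_col ?eq_sum // => k.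
under eq_bigr do rewrite rowQ_sqrt_col.
under [RHS]eq_bigr do rewrite rowQ_sqrt_col.
exact: (sum_rowQ_perm (fun j => Num.sqrt (a j)) p k).
Qed.

(** Permutation invariance lets both vectors be sorted; majorization then becomes domination of
    prefix sums. *)
Lemma moment_schur_concave q : schur_concave
  (fun a : 'I_n -> R => (forall i, 0 <= a i) /\ exists i, a i != 0)
  (fun a => moment m q (sqrt_col a)).
Proof.
move=> a b [a0 _] [b0 [i bi0]] [le_top eq_sum].
have sumb : 0 < \sum_i b i.
  rewrite (bigD1 i) //=; apply: ltr_pwDl; last exact: sumr_ge0.
  by rewrite lt_def bi0 b0.
have [pa [sorted_a topa]] := topsum_perm a.
have [pb [_ topb]] := topsum_perm b.
rewrite -(@moment_perm q a pa) ?eq_sum // -(@moment_perm q b pb) //.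
have sum_perm (c : 'I_n -> R) (p : {perm 'I_n}) : \sum_i (c \o p) i = \sum_i c i.
  by rewrite [RHS](reindex_inj (@perm_inj _ p)).
apply: (le_of_prefix_sums (@moment_sqrt_col_ext q) (@moment_transfer q)).
- by move=> l; apply: a0.
- by move=> l; apply: b0.
- exact: sorted_a.
- by move=> t tn /=; rewrite -topa // -topb // le_top.
- by rewrite !sum_perm.
by rewrite sum_perm.
Qed.

(* The generating polynomial of the count is [('X + 1) ^+ #|A| * 2 ^+ #|~: A|]. *)
Lemma sum_signs_binomial (A : {set 'I_n}) (h : nat -> R) :
  \sum_(s : {ffun 'I_n -> bool}) (2 ^+ n)^-1 * h (\sum_(i in A) s i)%N =
  \sum_(b < #|A|.+1) 'C(#|A|, b)%:R / 2 ^+ #|A| * h b.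
Proof.
pose cnt (s : {ffun 'I_n -> bool}) := (\sum_(i in A) s i)%N.
have cntK s : (cnt s < #|A|.+1)%N.
  by rewrite ltnS -sum1_card; apply: leq_sum => i _; case: (s i).
have gen : \sum_s 'X^(cnt s) = ('X + 1) ^+ #|A| * (2 ^+ #|~: A|)%:P :> {poly R}.
  have -> : \sum_s 'X^(cnt s) = \sum_(s : {ffun 'I_n -> bool})
      \prod_i (if i \in A then 'X^(s i) else 1) :> {poly R}.
    apply: eq_bigr => s _; rewrite -big_mkcond /= /cnt.
    exact: (big_morph _ (exprD _) (expr0 _)).
  rewrite -(bigA_distr_bigA (fun i (b : bool) => if i \in A then 'X^b else 1)) /=.
  rewrite (bigID (mem A)) /=; congr (_ * _).
    rewrite -prodr_const; apply: eq_bigr => i ->.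
    by rewrite big_bool /= expr1 expr0.
  rewrite rmorphXn -prodr_const; apply: eq_big => [i|i /negPf ->]; rewrite ?inE //.
  by rewrite big_bool /= polyCD.
(* Comparing coefficients of ['X^b] counts the sign vectors with [b] plus signs on [A]. *)
have count_eq (b : 'I_#|A|.+1) : \sum_(s | cnt s == b) 1 = 'C(#|A|, b)%:R * 2 ^+ #|~: A| :> R.
  have := congr1 (fun p : {poly R} => p`_b) gen.
  rewrite /= coefMC coef_sum => eqb.
  transitivity (\sum_s ('X^(cnt s) : {poly R})`_b).
    rewrite big_mkcond /=; apply: eq_bigr => s _.
    by rewrite coefXn eq_sym; case: eqP.
  rewrite eqb; congr (_ * _).
  rewrite exprD1n coef_sum (bigD1 b) //= big1 ?addr0 => [|i neq_ib].
    by rewrite coefMn coefXn eqxx.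
  by rewrite coefMn coefXn eq_sym val_eqE (negPf neq_ib) mul0rn.
have card2 : 2 ^+ n = 2 ^+ #|A| * 2 ^+ #|~: A| :> R.
  by rewrite -exprD cardsC card_ord.
have two0 k : 2 ^+ k != 0 :> R by rewrite expf_neq0 ?pnatr_eq0.
rewrite (partition_big (fun s => inord (cnt s) : 'I_#|A|.+1) xpredT) //=.
apply: eq_bigr => b _.
rewrite (eq_bigr (fun=> (2 ^+ n)^-1 * h b * 1)); last first.
  by move=> s /eqP <-; rewrite inordK // mulr1.
rewrite -mulr_sumr (eq_bigl (fun s => cnt s == b)); last first.
  by move=> s; rewrite -val_eqE /= inordK.
by rewrite count_eq card2; field; rewrite !two0.
Qed.

(** With [B] plus signs on [A] the signed sum is [c * (2 * B - K)], and [2 * B - K] divided by the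
    root of [K] is the standardized binomial; hence each row term has the law of a summand of the
    binomial average. *)
Lemma moment_indicator q (A : {set 'I_n}) (c : R) v : c != 0 -> (0 < #|A|)%N ->
    (forall i, v i 0 = if i \in A then c else 0) ->
  moment m q v = Estar_moment R m #|A| q.
Proof.
move=> c0 cardA defv; set K := #|A|.
have m0 : m%:R != 0 :> R by rewrite pnatr_eq0 -lt0n.
have K0 : K%:R != 0 :> R by rewrite pnatr_eq0 -lt0n.
have S_eq : sqnorm v = K%:R * c ^+ 2.
  rewrite /sqnorm (bigID (mem A)) /= [X in _ + X]big1 ?addr0; last first.
    by move=> i /negPf iA; rewrite defv iA expr0n.
  rewrite (eq_bigr (fun=> c ^+ 2)); last by move=> i iA; rewrite defv iA.
  by rewrite sumr_const mulr_natl.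
have v0 : v != 0.
  apply: contraNneq (mulf_neq0 K0 (expf_neq0 2 c0)) => v0.
  by rewrite -S_eq v0 /sqnorm big1 // => i _; rewrite mxE expr0n.
rewrite moment_iid //.
have -> : Estar_moment R m K q = iid_moment
    (fun b : 'I_K.+1 => 'C(K, b)%:R / 2 ^+ K)
    (fun b => (zstd R K b ^+ 2 - 1) / m%:R) m q.
  by apply: eq_bigr => b _; rewrite -mulr_suml [_^-1 * _]mulrC.
apply: eq_iid_moment => k.
rewrite -(sum_signs_binomial A (fun b => ((zstd R K b ^+ 2 - 1) / m%:R) ^+ k)).
apply: eq_bigr => s _; congr (_ * _ ^+ k).
have -> : rowQ s (fun j => v j 0) =
    (c * (2 * (\sum_(i in A) s i)%N%:R - K%:R)) ^+ 2 - sqnorm v.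
  rewrite /rowQ; congr (_ ^+ 2 - _).
  rewrite (bigID (mem A)) /= [X in _ + X]big1 ?addr0; last first.
    by move=> i /negPf iA; rewrite defv iA mulr0.
  rewrite /K -sum1_card !natr_sum mulr_sumr -sumrB mulr_sumr.
  by apply: eq_bigr => i iA; rewrite defv iA /sg; case: (s i) => /=; ring.
rewrite /zstd [in RHS]exprMn [in RHS]exprVn sqr_sqrtr ?divr_ge0 ?ler0n // S_eq.
by field; rewrite m0 K0 c0.
Qed.

Lemma moment_le_Estar q v : v != 0 -> moment m q v <= Estar_moment R m (l0 v) q.
Proof.
move=> v0; pose A := [set i : 'I_n | v i 0 != 0].
pose b i := v i 0 ^+ 2; have b0 i : 0 <= b i by apply: sqr_ge0.
have S0 := sqnorm_gt0 v0; have sumb : \sum_i b i = sqnorm v by [].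
have cardA : (0 < #|A|)%N.
  rewrite lt0n; apply: contraNneq v0 => /eqP; rewrite cards_eq0 => /eqP A0.
  apply/eqP/colP => i; rewrite mxE; apply/eqP.
  by have := in_set0 i; rewrite -A0 inE => /negbFE.
have K0 : 0 < #|A|%:R :> R by rewrite ltr0n.
(* The mean of the squares over the support, so that averaging keeps the norm. *)
pose c := sqnorm v / #|A|%:R; have c0 : 0 < c by rewrite divr_gt0.
have -> : moment m q v = moment m q (sqrt_col b).
  apply: moment_sqr; rewrite ?sqrt_col_neq0 ?sumb // => i.
  by rewrite mxE sqr_sqrtr.
have sum_avg : \sum_i (if i \in A then c else 0) = sqnorm v.
  by rewrite -big_mkcond /= sumr_const -mulr_natr divfK ?gt_eqF.
rewrite -(@moment_indicator q A (Num.sqrt c)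
           (sqrt_col (fun i => if i \in A then c else 0))) ?gt_eqF ?sqrtr_gt0 //.
  apply: (le_of_average (@moment_sqrt_col_ext q) (@moment_transfer q)) => //.
    exact: ltW.
  by move=> i; rewrite inE negbK => /eqP vi0; rewrite /b vi0 expr0n.
by move=> i; rewrite mxE; case: ifP; rewrite ?sqrtr0.
Qed.

End Moments.

Theorem theorem1 (R : rcfType) (m n : nat) :
  (0 < m)%N -> (0 < n)%N ->
  (* (a) *)
  (forall q : nat, (0 < q)%N ->
     (forall x y : 'cV[R]_n, x != 0 -> y != 0 ->
        (forall i, x i 0 ^+ 2 = y i 0 ^+ 2) -> moment m q x = moment m q y)
     /\ (exists P : {mpoly R[n]}, forall x : 'cV[R]_n, x != 0 ->
          sqnorm x ^+ q * moment m q x = P.@[fun i => x i 0 ^+ 2])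
     /\ schur_concave
          (fun a : 'I_n -> R => (forall i, 0 <= a i) /\ exists i, a i != 0)
          (fun a => moment m q (\col_i Num.sqrt (a i) : 'cV[R]_n)))
  /\
  (* (b) *)
  (forall q : nat, (2 <= q)%N ->
     (forall x : 'cV[R]_n, x != 0 -> moment m q x <= Estar_moment R m (l0 x) q)
     /\ (forall c : R, c != 0 ->
          moment m q (const_mx c : 'cV[R]_n) = Estar_moment R m (l0 (const_mx c : 'cV[R]_n)) q)).
Proof.
move=> m_gt0 n_gt0; split=> q _.
  split=> [x y|]; first exact: moment_sqr.
  by split; [apply: moment_poly | apply: moment_schur_concave].
split=> [x|c c0]; first exact: moment_le_Estar.
(* A nonzero constant vector has full support, nonempty since [0 < n]. *)
have defA : [set i | (const_mx c : 'cV[R]_n) i 0 != 0] = [set: 'I_n].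
  by apply/setP => i; rewrite !inE mxE c0.
apply: (moment_indicator m_gt0 q c0); rewrite defA ?cardsT ?card_ord //.
by move=> i; rewrite mxE inE.
Qed.
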